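(* Let $p=p(n)$ satisfy $n^{2/3}\ll np\le\sqrt{15}\,n^{3/4}(\log n)^{1/4}$. Consider the Alternative Label Attribution Procedure (ALAP) on $\mathcal G(n,p)$, and for $\ell\in[2k]$ let $\mathfrak B_2(\ell)$ be the number of vertices of $B$ that carry label $\ell$ after the second round of ALAP. Then, a.a.s. for every $\ell\in[2,2k]$, $$\mathfrak B_2(\ell)-\mathfrak B_2(1)\le 44\,np.$$
   Context: $\mathcal G(n,p)$ is the random graph on $V=\{v_1,\dots,v_n\}$ in which every pair is an edge independently with probability $p$. A.a.s. means with probability tending to $1$ as $n\to\infty$; $f\ll g$ means $f=o(g)$. $[a,b]=\{a,\dots,b\}$, $[n]=[1,n]$, and $N(v)$ is the set of neighbours of $v$. Set $k=k(n)=\lceil 15p^{-2}(n^{-1}\log n)^{1/2}\rceil$. Let $A=\{v_1,\dots,v_{2k}\}$ (Level 1), $B=\big(\bigcup_{v\in A}N(v)\big)\setminus A$ (Level 2), $C=V\setminus(A\cup B)$ (Level 3). For $\ell\in[2k]$ the basin of $v_\ell$ is $B_1(\ell)=N(v_\ell)\setminus\big(A\cup\bigcup_{i=1}^{\ell-1}N(v_i)\big)$. ALAP: initially $v_i$ has label $i$. At round 1, each vertex of $A\cup B$ receives the smallest label present in its closed neighbourhood (so the vertices of $B$ with label $\ell$ after round 1 are exactly those of $B_1(\ell)$). At round 2, for each vertex $u\in B\cup C$, let $U\subseteq[2k]$ be the set of labels $i$ maximizing $|N(u)\cap B_1(i)|$ over $i\in[2k]$; a label chosen uniformly at random from $U$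 (independently for different $u$ given the graph) is attributed to $u$. *)

(* Defs.v *)
From mathcomp Require Import all_boot all_order all_algebra.
From mathcomp Require Import all_classical all_reals all_analysis.
From mathcomp Require Import zify.

Set Implicit Arguments.
Unset Strict Implicit.
Unset Printing Implicit Defensive.

Import Order.TTheory GRing.Theory Num.Theory.
Import numFieldNormedType.Exports.

Local Open Scope ring_scope.

(* The vertex set is 'I_n, and the ordinal i stands for v_(i+1). Labels are
   numbered from 1 as usual, so the initial label of v : 'I_n is v.+1.
   A graph is given by its set E of edges, each a 2-element set of vertices. *)

Section Levels.
Variables (n k : nat) (E : {set {set 'I_n}}).

Definition adj (u v : 'I_n) : bool := (u != v) && ([set u; v] \in E).

Definition nbh (u : 'I_n) : {set 'I_n} := [set v | adj u v].

Definition level1 : {set 'I_n} := [set v : 'I_n | (v.+1 <= 2 * k)%N].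

Definition level2 : {set 'I_n} := (\bigcup_(v in level1) nbh v) :\: level1.

Definition level3 : {set 'I_n} := ~: (level1 :|: level2).

Definition basin1 (l : nat) : {set 'I_n} :=
  (\bigcup_(v : 'I_n | v.+1 == l) nbh v)
    :\: (level1 :|: \bigcup_(v : 'I_n | (v.+1 < l)%N) nbh v).

(* Only used on level1 and level2; the other vertices have no label yet. *)
Definition round1 (u : 'I_n) : nat :=
  ([arg min_(v < u | v \in u |: nbh u) (v : nat)]%N : 'I_n).+1.

(* Elements of 'I_(2 * k).+1 stand for labels, the value 0 being unused. *)
Definition max_labels (u : 'I_n) : {set 'I_(2 * k).+1} :=
  [set i : 'I_(2 * k).+1 | (0 < i)%N &
    [forall j : 'I_(2 * k).+1, (0 < j)%N ==>
       (#|nbh u :&: basin1 j| <= #|nbh u :&: basin1 i|)%N]].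

(* The number of level-2 vertices with label l under the labelling s. *)
Definition basin2_size (s : {ffun 'I_n -> 'I_(2 * k).+1}) (l : nat) : nat :=
  #|[set u in level2 | s u == l :> nat]|.

End Levels.

Section Law.
Variables (R : realType) (n k : nat) (p : R).

Definition pairs : {set {set 'I_n}} := [set e : {set 'I_n} | #|e| == 2].

Definition gnp_mass (E : {set {set 'I_n}}) : R :=
  if E \subset pairs then \prod_(e in pairs) (if e \in E then p else 1 - p)
  else 0.

(* The law of the label of u after the second round, given the graph: the
   vertices of level1 are not relabelled in that round. *)
Definition label_mass (E : {set {set 'I_n}}) (u : 'I_n)
    (l : 'I_(2 * k).+1) : R :=
  if u \in level2 k E :|: level3 k E then
    if l \in max_labels k E u then #|max_labels k E u|%:R^-1 else 0
  else (round1 E u == l)%:R.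

Definition labelling_mass (E : {set {set 'I_n}})
    (s : {ffun 'I_n -> 'I_(2 * k).+1}) : R :=
  \prod_(u : 'I_n) label_mass E u (s u).

(* The probability of an event depending on the random graph and on the labels
   after the second round. *)
Definition alap_pr
    (ev : {set {set 'I_n}} -> {ffun 'I_n -> 'I_(2 * k).+1} -> bool) : R :=
  \sum_(E : {set {set 'I_n}}) gnp_mass E *
    \sum_(s : {ffun 'I_n -> 'I_(2 * k).+1} | ev E s) labelling_mass E s.

End Law.

Definition alap_k (R : realType) (p : nat -> R) (n : nat) : nat :=
  `|Num.ceil (15 * (p n) ^- 2 * Num.sqrt (n%:R^-1 * ln n%:R))|%N.

Section Sanity.

Lemma level23E n k (E : {set {set 'I_n}}) :
  level2 k E :|: level3 k E = ~: level1 n k.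
Proof.
apply/setP => u; rewrite /level3 /level2 !inE.
by case: (u.+1 <= 2 * k)%N => //=; rewrite orbN.
Qed.

Lemma round1_le n (E : {set {set 'I_n}}) u : (round1 E u <= u.+1)%N.
Proof.
rewrite /round1; case: arg_minnP => [|v _ /(_ u)]; first by rewrite !inE eqxx.
by rewrite ltnS; apply; rewrite !inE eqxx.
Qed.

Lemma basin1_round1 n k (E : {set {set 'I_n}}) (l : nat) :
  (0 < l <= 2 * k)%N ->
  basin1 k E l = [set u in level2 k E | round1 E u == l].
Proof.
have adjC u v : adj E u v = adj E v u by rewrite /adj eq_sym finset.setUC.
case/andP=> l0 lk; apply/setP => u; rewrite /basin1 /level2 !inE.
have [uA|uA] := leqP u.+1 (2 * k) => //=.
rewrite /round1; case: arg_minnP => [|v]; first by rewrite !inE eqxx.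
rewrite !inE => vu vmin.
have vmin' w : adj E w u -> (v <= w)%N.
  by move=> wu; apply: vmin; rewrite !inE adjC wu orbT.
apply/idP/idP.
- case/andP=> /bigcupP nlt /bigcupP[w /eqP wl]; rewrite inE => wu.
  have vl : v.+1 = l.
    apply/eqP; rewrite eqn_leq -{1}wl ltnS vmin' //= leqNgt; apply/negP => vl.
    case/orP: vu => [/eqP vu|uv]; first by move: uA; rewrite -vu; lia.
    by apply: nlt; exists v; rewrite // inE adjC.
  rewrite vl eqxx andbT; apply/bigcupP; exists w; rewrite !inE ?wl //.
- case/andP=> /bigcupP[w wA wu] /eqP vl; apply/andP; split.
    apply/bigcupP => -[x]; rewrite inE => xl /vmin'; lia.
  apply/bigcupP; exists v; rewrite ?vl //.
  case/orP: vu => [/eqP vu|uv]; last by rewrite inE adjC.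
  by move: uA; rewrite -vu; lia.
Qed.

Variables (R : realType) (n k : nat) (p : R).

Lemma gnp_mass_ge0 (E : {set {set 'I_n}}) : 0 <= p <= 1 -> 0 <= gnp_mass p E.
Proof.
case/andP=> p0 p1; rewrite /gnp_mass; case: ifP => // _.
by apply: prodr_ge0 => e _; case: ifP; rewrite // subr_ge0.
Qed.

Lemma gnp_mass_sum1 : \sum_(E : {set {set 'I_n}}) gnp_mass p E = 1.
Proof.
pose F (e : {set 'I_n}) := if e \in pairs n then p else 0.
pose G (e : {set 'I_n}) := if e \in pairs n then 1 - p else 1.
transitivity (\prod_e (F e + G e)); last first.
  by apply: big1 => e _; rewrite /F /G; case: ifP; rewrite ?add0r // addrC subrK.
rewrite bigA_distr; apply: eq_bigr => E _; rewrite /gnp_mass.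
case: ifP => [/fintype.subsetP sE|/negbT/fintype.subsetPn[e eE eN]].
  rewrite [LHS]big_mkcond; apply: eq_bigr => e _; rewrite /F /G.
  by case: ifP => eP; case: ifP => // /sE; rewrite eP.
by rewrite (bigD1 e) //= eE /F (negbTE eN) mul0r.
Qed.

Lemma label_mass_ge0 (E : {set {set 'I_n}}) u (l : 'I_(2 * k).+1) :
  0 <= label_mass R E u l.
Proof. by rewrite /label_mass; case: ifP => // _; case: ifP. Qed.

Lemma max_labels_neq0 (E : {set {set 'I_n}}) u :
  (0 < k)%N -> (0 < #|max_labels k E u|)%N.
Proof.
move=> k0; have lt1 : (1 < (2 * k).+1)%N by lia.
pose f (i : 'I_(2 * k).+1) := #|nbh E u :&: basin1 k E i|.
pose P (i : 'I_(2 * k).+1) := (0 < i)%N.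
case: (@arg_maxnP _ (Ordinal lt1) P f isT) => i i0 imax.
apply/card_gt0P; exists i; rewrite inE (i0 : (0 < i)%N).
by apply/forallP => j; apply/implyP; apply: imax.
Qed.

Lemma labelling_mass_sum1 (E : {set {set 'I_n}}) : (0 < k)%N ->
  \sum_(s : {ffun 'I_n -> 'I_(2 * k).+1}) labelling_mass R E s = 1.
Proof.
move=> k0; rewrite /labelling_mass -bigA_distr_bigA; apply: big1 => u _.
rewrite /label_mass level23E; have [_|] := boolP (u \in ~: level1 n k).
  rewrite -big_mkcond sumr_const -[LHS]mulr_natr mulVf ?pnatr_eq0 -?lt0n //.
  exact: max_labels_neq0.
rewrite !inE => /negPn uA.
have lt : (round1 E u < (2 * k).+1)%N.
  by rewrite ltnS (leq_trans (round1_le _ _)).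
rewrite (bigD1 (Ordinal lt)) //= eqxx big1 ?addr0 // => i.
by rewrite -val_eqE /= eq_sym => /negbTE ->.
Qed.

Lemma alap_prT : (0 < k)%N -> alap_pr (n := n) (k := k) p (fun _ _ => true) = 1.
Proof.
move=> k0; rewrite /alap_pr -gnp_mass_sum1; apply: eq_bigr => E _.
by rewrite labelling_mass_sum1 // mulr1.
Qed.

End Sanity.

(* Main.v *)
(* Let M = n p, and let B_1(l) be the first-round basins. Since n p^3 tends to
   infinity, the Chebyshev inequality shows that a.a.s. B_1(1) is the largest
   basin and has at most 2M vertices. Fix such a first round and l >= 2. The
   vertices of B_1(1) and B_1(l) contribute at most 4M to the difference of the
   second-round sizes. For the other level-2 vertices u, condition on every edge
   except those joining them to B_1(1) and B_1(l): what each u then sees is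
   independent of what the others see, and an involution sending B_1(l) into
   B_1(1) shows that u is at least as likely to take label 1 as label l. There
   are at most 4kM such u, so the Chebyshev inequality, applied to these edges
   and then to the random labels, bounds by O(k/M) the probability that their
   contribution exceeds 40M. The union bound over l costs O(k^2/M), which tends
   to 0. *)
Require Import Defs.
From mathcomp Require Import all_boot all_order all_algebra.
From mathcomp Require Import all_classical all_reals all_analysis.
From mathcomp Require Import ring lra zify.
Import Order.TTheory GRing.Theory Num.Theory.
Import numFieldNormedType.Exports.
Local Open Scope ring_scope.

Set Implicit Arguments.
Unset Strict Implicit.
Unset Printing Implicit Defensive.

(** * Product measures on finite spaces *)

Section Expectation.
Variables (R : realFieldType) (T : finType) (w : T -> R).
Hypotheses (w_ge0 : forall x, 0 <= w x) (w_sum1 : \sum_x w x = 1).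

Definition Ex (F : T -> R) : R := \sum_x w x * F x.

Lemma ExD F G : Ex (fun x => F x + G x) = Ex F + Ex G.
Proof. by rewrite /Ex -big_split; apply: eq_bigr => x _; rewrite mulrDr. Qed.

Lemma ExZ a F : Ex (fun x => a * F x) = a * Ex F.
Proof. by rewrite /Ex mulr_sumr; apply: eq_bigr => x _; rewrite mulrCA. Qed.

Lemma ExB F G : Ex (fun x => F x - G x) = Ex F - Ex G.
Proof. by rewrite -mulN1r -ExZ -ExD; apply: eq_bigr => x _; rewrite mulN1r. Qed.

Lemma Ex_cst a : Ex (fun=> a) = a.
Proof. by rewrite /Ex -mulr_suml w_sum1 mul1r. Qed.

Lemma Ex_sum (I : finType) (P : pred I) (F : I -> T -> R) :
  Ex (fun x => \sum_(i | P i) F i x) = \sum_(i | P i) Ex (F i).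
Proof.
by rewrite exchange_big; apply: eq_bigr => x _; rewrite mulr_sumr.
Qed.

Lemma eq_Ex F G : F =1 G -> Ex F = Ex G.
Proof. by move=> FG; apply: eq_bigr => x _; rewrite FG. Qed.

Lemma Ex_delta a : Ex (fun x => (x == a)%:R) = w a.
Proof.
rewrite /Ex (bigD1 a) //= eqxx mulr1 big1 ?addr0 // => x /negbTE ->.
by rewrite mulr0.
Qed.

Lemma le_Ex F G : (forall x, F x <= G x) -> Ex F <= Ex G.
Proof. by move=> FG; apply: ler_sum => x _; apply: ler_wpM2l. Qed.

(** Uncorrelatedness kills the off-diagonal terms in the variance of the sum. The bound uses second
    moments, which are easier to estimate than variances and dominate them. *)
Lemma chebyshev (U : finType) (W : {set U}) (Z : U -> T -> R) (t : R) :
    {in W &, forall u v, u != v ->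
       Ex (fun x => Z u x * Z v x) = Ex (Z u) * Ex (Z v)} ->
    0 < t ->
  Ex (fun x => (\sum_(u in W) Ex (Z u) + t <= \sum_(u in W) Z u x)%R%:R)
    <= (\sum_(u in W) Ex (fun x => Z u x ^+ 2)) / t ^+ 2.
Proof.
move=> Zuncor t0; rewrite ler_pdivlMr ?exprn_gt0 // mulrC -ExZ.
pose Y u x : R := Z u x - Ex (Z u).
have YY u v : Ex (fun x => Y u x * Y v x) =
    Ex (fun x => Z u x * Z v x) - Ex (Z u) * Ex (Z v).
  transitivity (Ex (fun x => Z u x * Z v x - Ex (Z u) * Z v x
                             - (Ex (Z v) * Z u x - Ex (Z u) * Ex (Z v)))).
    by apply: eq_Ex => x; rewrite /Y; ring.
  by rewrite 3!ExB !ExZ Ex_cst; ring.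
(* Each second moment is a variance plus a squared mean; the squared means are discarded below. *)
have -> : \sum_(u in W) Ex (fun x => Z u x ^+ 2) =
    Ex (fun x => (\sum_(u in W) Y u x) ^+ 2) + \sum_(u in W) Ex (Z u) ^+ 2.
  have -> : Ex (fun x => (\sum_(u in W) Y u x) ^+ 2) =
      \sum_(u in W) \sum_(v in W) Ex (fun x => Y u x * Y v x).
    rewrite (eq_Ex (G := fun x => \sum_(u in W) \sum_(v in W) Y u x * Y v x)).
      by rewrite Ex_sum; apply: eq_bigr => u _; rewrite Ex_sum.
    move=> x; rewrite expr2 mulr_suml; apply: eq_bigr => u _.
    by rewrite mulr_sumr.
  rewrite -big_split; apply: eq_bigr => u uW /=.
  rewrite (bigD1 u) //= big1 => [|v /andP[vW vu]]; last first.
    by rewrite YY Zuncor ?subrr // eq_sym.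
  by rewrite addr0 YY -expr2 subrK.
apply: ler_wpDr; first by apply: sumr_ge0 => u _; apply: sqr_ge0.
apply: le_Ex => x; case: (leP (_ + t) _) => [le|_];
  last by rewrite mulr0 sqr_ge0.
rewrite mulr1 ler_sqr ?nnegrE; [|exact: ltW|].
  by rewrite sumrB lerBrDl.
by rewrite sumrB subr_ge0; apply: le_trans le; rewrite lerDl ltW.
Qed.

End Expectation.

Section Product.
Variables (R : realFieldType) (I T : finType) (w : I -> T -> R).
Hypotheses (w_ge0 : forall i x, 0 <= w i x).
Hypothesis w_sum1 : forall i, \sum_x w i x = 1.

Definition pmass (f : {ffun I -> T}) : R := \prod_i w i (f i).

Lemma pmass_ge0 f : 0 <= pmass f.
Proof. exact: prodr_ge0. Qed.

Lemma Ex_prod (phi : I -> T -> R) :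
  Ex pmass (fun f => \prod_i phi i (f i)) = \prod_i Ex (w i) (phi i).
Proof.
rewrite /Ex bigA_distr_bigA; apply: eq_bigr => f _.
by rewrite /pmass -big_split.
Qed.

Lemma pmass_sum1 : \sum_f pmass f = 1.
Proof.
by rewrite /pmass -bigA_distr_bigA; apply: big1 => i _; apply: w_sum1.
Qed.

(** The integrand is a product over all coordinates, with factor 1 away from [i], so [Ex_prod]
    applies. *)
Lemma Ex_marginal (i : I) (phi : T -> R) :
  Ex pmass (fun f => phi (f i)) = Ex (w i) phi.
Proof.
pose psi j x := if j == i then phi x else 1.
transitivity (Ex pmass (fun f => \prod_j psi j (f j))); last first.
  rewrite Ex_prod (bigD1 i) //= big1 => [|j ji].
    by rewrite mulr1; apply: eq_Ex => x; rewrite /psi eqxx.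
  by rewrite /psi (negbTE ji) Ex_cst.
apply: eq_Ex => f.
rewrite (bigD1 i) //= big1 => [|j ji]; last by rewrite /psi (negbTE ji).
by rewrite /psi eqxx mulr1.
Qed.

Definition mix (S : {set I}) (f g : {ffun I -> T}) : {ffun I -> T} :=
  [ffun i => if i \in S then g i else f i].

(* The map (f, g) |-> (mix (S f) f g, mix (S f) g f) is a mass-preserving
   involution, because it does not change S f. *)
Lemma resample (S : {ffun I -> T} -> {set I}) (F : {ffun I -> T} -> R) :
    (forall f g, S (mix (S f) f g) = S f) ->
  Ex pmass F = Ex pmass (fun f => Ex pmass (fun g => F (mix (S f) f g))).
Proof.
move=> Smix; pose h (x : {ffun I -> T} * {ffun I -> T}) :=
  (mix (S x.1) x.1 x.2, mix (S x.1) x.2 x.1).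
have hK : involutive h.
  case=> f g; rewrite /h /= Smix.
  by congr (_, _); apply/ffunP => i; rewrite !ffunE; case: (i \in S f).
transitivity (\sum_x pmass x.1 * pmass x.2 * F x.1).
  rewrite -(pair_bigA _ (fun f g => pmass f * pmass g * F f)) /=.
  apply: eq_bigr => f _; rewrite -mulr_suml -mulr_sumr.
  by rewrite pmass_sum1 mulr1.
rewrite (reindex_inj (inv_inj hK)) /=.
transitivity (\sum_x pmass x.1 * pmass x.2 * F (mix (S x.1) x.1 x.2)).
  apply: eq_bigr => -[f g] _ /=; congr (_ * _).
  rewrite /pmass -!big_split; apply: eq_bigr => i _; rewrite !ffunE /=.
  by case: ifP => // _; rewrite mulrC.
rewrite -(pair_bigA _ (fun f g => pmass f * pmass g * F (mix (S f) f g))) /=.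
by apply: eq_bigr => f _; rewrite mulr_sumr; apply: eq_bigr => g _;
  rewrite mulrA.
Qed.

Definition depends_on (S : {set I}) (F : {ffun I -> T} -> R) : Prop :=
  forall f g : {ffun I -> T}, {in S, f =1 g} -> F f = F g.

(** After resampling the fixed set [S], [F] sees only the new sample and [G] only the old one, so
    the double expectation factors. *)
Lemma Ex_indep (S S' : {set I}) F G :
    depends_on S F -> depends_on S' G -> [disjoint S & S'] ->
  Ex pmass (fun f => F f * G f) = Ex pmass F * Ex pmass G.
Proof.
move=> FS GS' dSS'; rewrite (resample (S := fun=> S)) //.
rewrite -ExZ; apply: eq_Ex => f; rewrite mulrC -ExZ; apply: eq_Ex => g.
rewrite mulrC; congr (_ * _).
  by apply: GS' => i iS'; rewrite ffunE (disjointFl dSS' iS').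
by apply: FS => i iS; rewrite ffunE iS.
Qed.

End Product.

(** * Maximal labels *)

(** [h] exchanges [X] with the first [#|X|] elements of an enumeration of [Y] and fixes everything
    else, including the rest of [Y]. *)
Lemma swap_into (T : finType) (X Y : {set T}) :
    [disjoint X & Y] -> (#|X| <= #|Y|)%N ->
  exists h : T -> T, [/\ involutive h, forall x, x \in X -> h x \in Y &
    forall z, z \notin X -> z \notin Y -> h z = z].
Proof.
move=> dXY leXY; pose sX := enum X; pose sY := take #|X| (enum Y).
have szX : size sX = #|X| by rewrite -cardE.
have szY : size sY = #|X| by rewrite size_takel // -cardE.
have uX : uniq sX by apply: enum_uniq.
have uY : uniq sY by rewrite take_uniq ?enum_uniq.
have sYY z : z \in sY -> z \in Y by move/mem_take; rewrite mem_enum.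
have sXE z : (z \in sX) = (z \in X) by rewrite mem_enum.
have dis z : z \in sX -> z \in sY = false.
  by rewrite sXE => zX; apply/negP => /sYY; rewrite (disjointFr dXY zX).
pose h z := if z \in sX then nth z sY (index z sX)
  else if z \in sY then nth z sX (index z sY) else z.
have hX z : z \in sX -> h z = nth z sY (index z sX) by rewrite /h => ->.
have hY z : z \in sY -> h z = nth z sX (index z sY).
  by rewrite /h => zY; case: ifP => [/dis|]; rewrite zY.
have hXY z : z \in sX -> h z \in sY.
  by move=> zX; rewrite hX // mem_nth // szY -szX index_mem.
have hYX z : z \in sY -> h z \in sX.
  by move=> zY; rewrite hY // mem_nth // szX -szY index_mem.
exists h; split=> [z|x|z zX zY].
- have [zX|zX] := boolP (z \in sX).
    rewrite hY ?hXY // hX // index_uniq ?nth_index //.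
    by rewrite szY -szX index_mem.
  have [zY|zY] := boolP (z \in sY).
    rewrite hX ?hYX // hY // index_uniq ?nth_index //.
    by rewrite szX -szY index_mem.
  by rewrite {2}/h (negbTE zX) (negbTE zY) /h (negbTE zX) (negbTE zY).
- by rewrite -sXE => /hXY/sYY.
- by rewrite /h sXE (negbTE zX); case: ifP => // /sYY; rewrite (negbTE zY).
Qed.

Section Share.
Variables (R : realType) (m : nat).
Implicit Types c x y : 'I_m.+1 -> nat.

(** The rule of [max_labels] for arbitrary vote counts [c], so that counts can be compared without
    reference to a graph. *)
Definition argmaxes c : {set 'I_m.+1} :=
  [set i : 'I_m.+1 | (0 < i)%N &
    [forall j : 'I_m.+1, (0 < j)%N ==> (c j <= c i)%N]].

Lemma argmaxesP c (i : 'I_m.+1) :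
  reflect ((0 < i)%N /\ forall j : 'I_m.+1, (0 < j)%N -> (c j <= c i)%N)
    (i \in argmaxes c).
Proof.
rewrite inE; apply: (iffP andP) => -[i0 H]; split=> //.
  by move=> j j0; move/forallP/(_ j)/implyP: H; apply.
by apply/forallP => j; apply/implyP; apply: H.
Qed.

Definition share c (i : 'I_m.+1) : R :=
  if i \in argmaxes c then #|argmaxes c|%:R^-1 else 0.

Lemma share_ge0 c (i : 'I_m.+1) : 0 <= share c i.
Proof. by rewrite /share; case: ifP. Qed.

Lemma share_le1 c (i : 'I_m.+1) : share c i <= 1.
Proof.
rewrite /share; case: ifP => // iU; rewrite invf_le1 ?ler1n ?ltr0n //;
  by apply/card_gt0P; exists i.
Qed.

Lemma share_le c (a b : 'I_m.+1) :
  (a \in argmaxes c -> b \in argmaxes c) -> share c a <= share c b.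
Proof. by rewrite /share; case: ifP => [_ -> //|_ _]; case: ifP. Qed.

(** Passing from [x] to [y], [b] inherits at least the count of [a] and [a] at most that of [b]. So
    [b] replaces [a] among the winners and no other new winner appears: ties do not grow, and [b]
    gets at least the former share of [a]. *)
Lemma share_transfer (a b : 'I_m.+1) x y :
    (0 < b)%N -> (forall j, j != a -> j != b -> x j = y j) ->
    (y a <= x b)%N -> (x a <= y b)%N ->
    a \in argmaxes x -> b \notin argmaxes x ->
  share x a <= share y b /\ share y a = 0.
Proof.
move=> b0 xy yaxb xayb aU bU; have [a0 xa] := argmaxesP _ _ aU.
have xbxa : (x b < x a)%N.
  rewrite ltnNge; apply: contra bU => xaxb; apply/argmaxesP; split=> // j j0.
  exact: leq_trans (xa j j0) xaxb.
have bUy : b \in argmaxes y.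
  apply/argmaxesP; split=> // j j0; have [->|ja] := eqVneq j a; first by lia.
  have [->//|jb] := eqVneq j b.
  by rewrite -xy //; apply: leq_trans (xa j j0) xayb.
have aUy : a \notin argmaxes y.
  by apply/argmaxesP => -[_ /(_ b b0)]; lia.
(* A winner of [y] other than [b] has kept its count, which is at least [y b], hence at least the
   old maximum [x a]. *)
have sub : argmaxes y \subset b |: (argmaxes x :\ a).
  apply/fintype.subsetP => j jU; have [j0 yj] := argmaxesP _ _ jU.
  rewrite !inE; have [//|jb /=] := eqVneq j b.
  have [ja|ja /=] := eqVneq j a; first by rewrite -ja jU in aUy.
  rewrite -[_ && _]/(_ && _) j0 /=; apply/forallP => i; apply/implyP => i0.
  rewrite (xy j) //; apply: leq_trans (xa i i0) (leq_trans xayb _).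
  exact: yj.
rewrite /share aU bUy (negbTE aUy); split=> //.
have y0 : (0 < #|argmaxes y|)%N by apply/card_gt0P; exists b.
have yx : (#|argmaxes y| <= #|argmaxes x|)%N.
  apply: leq_trans (subset_leq_card sub) _.
  by rewrite (cardsD1 a (argmaxes x)) aU cardsU1 leq_add2r leq_b1.
by rewrite lef_pV2 ?ler_nat // posrE ltr0n // (leq_trans y0).
Qed.

(** If [a] wins without [b] in one of the two counts, [share_transfer] compensates in the other; the
    hypotheses are symmetric in [x] and [y]. Otherwise [b] wins whenever [a] does, and both
    differences are nonpositive. *)
Lemma share_swap (a b : 'I_m.+1) x y :
    (0 < b)%N -> (forall j, j != a -> j != b -> x j = y j) ->
    (y a <= x b)%N -> (x a <= y b)%N ->
  (share x a - share x b) + (share y a - share y b) <= 0.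
Proof.
move=> b0 xy yaxb xayb.
have [/andP[aU bU]|xU] := boolP ((a \in argmaxes x) && (b \notin argmaxes x)).
  have [] := share_transfer b0 xy yaxb xayb aU bU.
  by have := share_ge0 x b; lra.
have [/andP[aU bU]|yU] := boolP ((a \in argmaxes y) && (b \notin argmaxes y)).
  have yx j : j != a -> j != b -> y j = x j by move=> *; rewrite xy.
  have [] := share_transfer b0 yx xayb yaxb aU bU.
  by have := share_ge0 y b; lra.
have : share x a <= share x b.
  by apply: share_le => aU; move: xU; rewrite aU negbK.
have : share y a <= share y b.
  by apply: share_le => aU; move: yU; rewrite aU negbK.
lra.
Qed.

End Share.

(** * The random graph as a product of independent edges *)

Section EdgeLaw.
Variables (R : realType) (n : nat) (p : R).
Hypothesis p01 : 0 <= p <= 1.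

(** Coordinates range over all vertex sets, to have a product over a full finite type; a set that is
    not a pair is almost surely absent. *)
Definition edge_wt (e : {set 'I_n}) (b : bool) : R :=
  if e \in pairs n then (if b then p else 1 - p) else (~~ b)%:R.

Lemma edge_wt_ge0 e b : 0 <= edge_wt e b.
Proof.
by case/andP: p01 => p0 p1; rewrite /edge_wt; do 2?case: ifP;
  rewrite // subr_ge0.
Qed.

Lemma edge_wt_sum1 e : \sum_b edge_wt e b = 1.
Proof.
by rewrite big_bool /edge_wt /=; case: ifP => _;
  [rewrite addrC subrK|rewrite add0r].
Qed.

Local Notation law := (pmass edge_wt).

Definition edges (f : {ffun {set 'I_n} -> bool}) : {set {set 'I_n}} :=
  [set e | f e].

Lemma adj_edges f u v : adj (edges f) u v = (u != v) && f [set u; v].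
Proof. by rewrite /adj inE. Qed.

Lemma gnp_Ex (F : {set {set 'I_n}} -> R) :
  \sum_E gnp_mass p E * F E = Ex law (fun f => F (edges f)).
Proof.
rewrite (reindex edges) /=; last first.
  exists (fun E : {set {set 'I_n}} => [ffun e => e \in E]) => [f|E] _.
    by apply/ffunP => e; rewrite ffunE inE.
  by apply/setP => e; rewrite inE ffunE.
apply: eq_bigr => f _; congr (_ * _); rewrite /gnp_mass /pmass.
case: ifP => [/fintype.subsetP sE|/negbT/fintype.subsetPn[e eE eN]].
  rewrite [LHS]big_mkcond; apply: eq_bigr => e _; rewrite /edge_wt.
  case: ifPn => [|eN]; first by rewrite [e \in edges f]inE.
  by case fe: (f e) => //; case/negP: eN; apply: sE; rewrite inE.
rewrite inE in eE.
by rewrite (bigD1 e) //= /edge_wt (negbTE eN) eE mul0r.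
Qed.

(** Permuting the vertices preserves the law, since the weight of a set depends only on its
    cardinality. *)
Lemma Ex_relabel (h : 'I_n -> 'I_n) (F : {ffun {set 'I_n} -> bool} -> R) :
    involutive h ->
  Ex law F = Ex law (fun g => F [ffun e : {set 'I_n} => g (h @: e)]).
Proof.
move=> hK; have tK : involutive (fun e : {set 'I_n} => h @: e).
  by move=> e; rewrite -imset_comp (eq_imset _ hK) imset_id.
pose r (g : {ffun {set 'I_n} -> bool}) : {ffun {set 'I_n} -> bool} :=
  [ffun e : {set 'I_n} => g (h @: e)].
have rK : involutive r by move=> g; apply/ffunP => e; rewrite !ffunE tK.
rewrite /Ex (reindex_inj (inv_inj rK)); apply: eq_bigr => g _.
congr (_ * _); rewrite /pmass [LHS](reindex_inj (inv_inj tK)).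
apply: eq_bigr => e _; rewrite ffunE tK /edge_wt !inE.
by rewrite card_imset //; apply: inv_inj.
Qed.

End EdgeLaw.

(** * Resampling in the second round *)

Lemma adjC n (E : {set {set 'I_n}}) u v : adj E u v = adj E v u.
Proof. by rewrite /adj eq_sym finset.setUC. Qed.

Section SecondRound.
Variables n k : nat.
Implicit Types (f g : {ffun {set 'I_n} -> bool}) (u v w : 'I_n).

Local Notation edges := (@edges n).
Local Notation basin f j := (basin1 k (edges f) j).

(** The edges that determine Level 2 and all the basins. Changing other edges leaves these
    unchanged. *)
Definition top_edges : {set {set 'I_n}} :=
  [set e : {set 'I_n} | [exists v in level1 n k, v \in e]].

Lemma nbh_top f g v : {in top_edges, f =1 g} -> v \in level1 n k ->
  nbh (edges f) v = nbh (edges g) v.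
Proof.
move=> fg vA; apply/setP => w; rewrite !inE !adj_edges; case: eqP => //= _.
by apply: fg; rewrite inE; apply/existsP; exists v; rewrite vA !inE eqxx.
Qed.

Lemma level2_top f g : {in top_edges, f =1 g} ->
  level2 k (edges f) = level2 k (edges g).
Proof.
move=> fg; rewrite /level2; congr (_ :\: _); apply: eq_bigr => v.
exact: nbh_top.
Qed.

Lemma basin_top f g j : {in top_edges, f =1 g} -> (j <= 2 * k)%N ->
  basin f j = basin g j.
Proof.
move=> fg jk; rewrite /basin1; congr (_ :\: (_ :|: _)).
  by apply: eq_bigr => v /eqP vj; apply: nbh_top => //; rewrite inE vj.
apply: eq_bigr => v vj; apply: nbh_top => //; rewrite inE.
by apply: leq_trans (ltnW vj) jk.
Qed.

Lemma basinS f j u : (0 < j <= 2 * k)%N -> u \in basin f j ->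
  u \in level2 k (edges f).
Proof. by move=> jk; rewrite basin1_round1 // inE => /andP[]. Qed.

(** By [basin1_round1] the basins are the fibres of [round1] on Level 2. *)
Lemma basin_disjoint f i j u : (0 < i <= 2 * k)%N -> (0 < j <= 2 * k)%N ->
  u \in basin f i -> u \in basin f j -> i = j.
Proof.
move=> ik jk; rewrite !basin1_round1 // !inE => /andP[_ /eqP <-].
by case/andP=> _ /eqP.
Qed.

Lemma level2_cover f u : u \in level2 k (edges f) ->
  exists j : 'I_(2 * k).+1, (0 < j)%N /\ u \in basin f j.
Proof.
move=> uB; have r1 : (round1 (edges f) u <= 2 * k)%N.
  move: (uB); rewrite !inE => /andP[_ /bigcupP[v]]; rewrite !inE => vA vu.
  rewrite /round1; case: arg_minnP => [|w wu wmin]; first by rewrite !inE eqxx.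
  apply: leq_trans vA; apply: wmin; rewrite !inE.
  by rewrite adjC vu orbT.
exists (Ordinal (r1 : (round1 (edges f) u < (2 * k).+1)%N)); split=> //.
by rewrite basin1_round1 ?r1 // inE uB eqxx.
Qed.

Lemma level2_notin1 f u : u \in level2 k (edges f) -> u \notin level1 n k.
Proof. by rewrite inE => /andP[]. Qed.

Variable l : 'I_(2 * k).+1.
Hypothesis l2 : (2 <= l)%N.

Let one : 'I_(2 * k).+1 := inord 1.

Lemma val_one : one = 1%N :> nat.
Proof. by rewrite /one inordK //; have := ltn_ord l; lia. Qed.

(* Label l competes with label 1: voters are the level-2 vertices outside both
   basins, and their ballots are the edges that get resampled. *)
Definition contest f : {set 'I_n} := basin f 1 :|: basin f l.

Definition voters f : {set 'I_n} := level2 k (edges f) :\: contest f.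

Definition ballots f u : {set {set 'I_n}} :=
  [set [set u; b] | b in contest f].

Definition all_ballots f : {set {set 'I_n}} :=
  \bigcup_(u in voters f) ballots f u.

Let l_range : (0 < l <= 2 * k)%N.
Proof. by have := ltn_ord l; lia. Qed.

Let one_range : (0 < 1 <= 2 * k)%N.
Proof. by have := ltn_ord l; lia. Qed.

Lemma contest_level2 f u : u \in contest f -> u \in level2 k (edges f).
Proof. by rewrite inE => /orP[]; apply: basinS. Qed.

(** A ballot has exactly one end outside the contested basins, and that end is its voter. *)
Lemma ballot_inj f u v b c : u \in voters f -> v \in voters f ->
  b \in contest f -> c \in contest f -> [set u; b] = [set v; c] -> u = v.
Proof.
rewrite inE => /andP[uT _] _ _ cT E.
have : u \in [set v; c] by rewrite -E !inE eqxx.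
rewrite !inE => /orP[/eqP //|/eqP uc].
by move: uT; rewrite uc cT.
Qed.

Lemma ballots_disjoint f u v : u \in voters f -> v \in voters f -> u != v ->
  [disjoint ballots f u & ballots f v].
Proof.
move=> uW vW uv; apply/pred0P => e /=; apply/negP.
case/andP=> /imsetP[b bT ->] /imsetP[c cT] E.
by case/eqP: uv; exact: ballot_inj uW vW bT cT E.
Qed.

(** Both ends of a ballot lie in Level 2, hence outside Level 1, so resampling the ballots does not
    alter the first round. *)
Lemma mix_top f g : {in top_edges, mix (all_ballots f) f g =1 f}.
Proof.
move=> e; rewrite inE => /existsP[v /andP[vA ve]]; rewrite ffunE.
case: ifP => // /bigcupP[u uW /imsetP[b bT eE]].
move: ve; rewrite eE !inE => /orP[/eqP vu|/eqP vb].
  by move: uW; rewrite inE => /andP[_ /level2_notin1]; rewrite -vu vA.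
by move/contest_level2/level2_notin1: bT; rewrite -vb vA.
Qed.

Lemma contest_top f g : {in top_edges, f =1 g} -> contest f = contest g.
Proof.
by move=> fg; rewrite /contest !(basin_top fg) //; case/andP: l_range => //;
  case/andP: one_range.
Qed.

Lemma voters_top f g : {in top_edges, f =1 g} -> voters f = voters g.
Proof.
by move=> fg; rewrite /voters (level2_top fg) (contest_top fg).
Qed.

(** This is the invariance required by [resample]: the set of ballots is determined by the first
    round. *)
Lemma all_ballots_mix f g :
  all_ballots (mix (all_ballots f) f g) = all_ballots f.
Proof.
rewrite /all_ballots (voters_top (mix_top f g)).
by apply: eq_bigr => u _; rewrite /ballots (contest_top (mix_top f g)).
Qed.

Definition votes f u g (j : 'I_(2 * k).+1) : nat :=
  #|[set b in basin f j | if (j == one) || (j == l) then g [set u; b]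
                          else adj (edges f) u b]|.

Variable R : realType.

Definition lead f u g : R :=
  share R (votes f u g) l - share R (votes f u g) one.

Lemma mix_votes f g u (j : 'I_(2 * k).+1) : u \in voters f -> (0 < j)%N ->
  #|nbh (edges (mix (all_ballots f) f g)) u
     :&: basin (mix (all_ballots f) f g) j| = votes f u g j.
Proof.
move=> uW j0; have jk : (j <= 2 * k)%N by have := ltn_ord j; lia.
rewrite (basin_top (mix_top f g)) //; apply: eq_card => b.
rewrite finset.in_setI [b \in nbh _ _]inE [RHS]inE adj_edges andbC.
case bj: (b \in basin f j) => //=.
case: ifPn => [jT|].
  have bT : b \in contest f.
    by rewrite inE; case/orP: jT => /eqP jE; move: bj;
      rewrite jE ?val_one => ->; rewrite ?orbT.
  have -> /= : u != b.
    by apply/eqP => ub; move: uW; rewrite inE ub bT.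
  rewrite ffunE; have -> // : [set u; b] \in all_ballots f.
  by apply/bigcupP; exists u => //; apply/imsetP; exists b.
rewrite negb_or => /andP[j1 jl]; rewrite adj_edges; case: eqP => //= _.
rewrite ffunE; case: ifP => // /bigcupP[v vW /imsetP[c cT E]].
(* For a third label neither [u] nor [b] lies in a contested basin, so their pair is not a ballot
   and keeps its value in [f]. *)
have uT : u \notin contest f by move: uW; rewrite inE => /andP[].
have bT : b \notin contest f.
  rewrite inE negb_or; apply/andP; split; apply/negP => bB.
    case/eqP: j1; apply: ord_inj; rewrite val_one.
    by apply: basin_disjoint bj bB; rewrite ?j0.
  case/eqP: jl; apply/val_inj => /=.
  by apply: basin_disjoint bj bB; rewrite ?j0.
have : c \in [set u; b] by rewrite E !inE eqxx orbT.
by rewrite !inE => /orP[] /eqP cE; [move: uT|move: bT]; rewrite -cE cT.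
Qed.

Lemma eq_share (c c' : 'I_(2 * k).+1 -> nat) (i : 'I_(2 * k).+1) :
  (forall j : 'I_(2 * k).+1, (0 < j)%N -> c j = c' j) ->
  share R c i = share R c' i.
Proof.
move=> cc'; suff E : argmaxes c = argmaxes c' by rewrite /share E.
apply/setP => j; rewrite !inE; case: (posnP j) => //= j0.
apply: eq_forallb => i'.
by case: posnP => //= i0; rewrite !cc'.
Qed.

Lemma label_mass_share (E : {set {set 'I_n}}) u (i : 'I_(2 * k).+1) :
  u \in level2 k E ->
  label_mass R E u i = share R (fun j => #|nbh E u :&: basin1 k E j|) i.
Proof. by move=> uB; rewrite /label_mass inE uB. Qed.

Lemma lead_mix f g u : u \in voters f ->
  label_mass R (edges (mix (all_ballots f) f g)) u l -
  label_mass R (edges (mix (all_ballots f) f g)) u one = lead f u g.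
Proof.
move=> uW; have uB : u \in level2 k (edges (mix (all_ballots f) f g)).
  by rewrite (level2_top (mix_top f g)); move: uW; rewrite inE => /andP[].
by rewrite !label_mass_share // /lead; congr (_ - _); apply: eq_share => j j0;
  apply: mix_votes.
Qed.

Lemma lead_sqr_le1 f u g : lead f u g ^+ 2 <= 1.
Proof.
rewrite /lead; have := share_ge0 R (votes f u g) l.
have := share_le1 R (votes f u g) l; have := share_ge0 R (votes f u g) one.
by have := share_le1 R (votes f u g) one; nra.
Qed.

(** With the disjointness of ballots, this makes the leads at distinct voters independent once [f]
    is fixed. *)
Lemma lead_depends f u : depends_on (ballots f u) (lead f u).
Proof.
move=> g g' gg'; rewrite /lead; suff E : votes f u g =1 votes f u g'.
  by congr (_ - _); apply: eq_share => j _; apply: E.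
move=> j; apply: eq_card => b; rewrite [LHS]inE [RHS]inE.
case bj: (b \in basin f j) => //=.
case: ifP => // jT; apply: gg'; apply/imsetP; exists b => //.
by rewrite inE; case/orP: jT => /eqP jE; move: bj; rewrite jE ?val_one => ->;
  rewrite ?orbT.
Qed.

Variable p : R.
Hypothesis p01 : 0 <= p <= 1.

Local Notation law := (pmass (edge_wt (n := n) p)).

Lemma lead_mean_le0 f u : (#|basin f l| <= #|basin f 1|)%N ->
  u \in voters f -> Ex law (lead f u) <= 0.
Proof.
move=> lel1 uW.
have dis : [disjoint basin f l & basin f 1].
  apply/pred0P => b /=; apply/negP => /andP[bl b1].
  by have := basin_disjoint l_range one_range bl b1; lia.
(* Averaging over the swap h makes the lead of l nonpositive pointwise. *)
have [h [hK hl hid]] := swap_into dis lel1.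
have hu : h u = u.
  by move: uW; rewrite finset.in_setD finset.in_setU negb_or =>
    /andP[/andP[u1 ul] _]; apply: hid.
have hpair b : [set h x | x in [set u; b]] = [set u; h b].
  by rewrite imsetU !imset_set1 hu.
suff : Ex law (lead f u) + Ex law (lead f u) <= 0 by lra.
rewrite {2}(Ex_relabel p (lead f u) hK) -ExD.
have <- : Ex law (fun=> 0) = 0.
  by apply: Ex_cst; apply/pmass_sum1/edge_wt_sum1.
apply: le_Ex => [g|g]; first exact/pmass_ge0/edge_wt_ge0.
have lo : l != one by rewrite -val_eqE /= val_one; lia.
have h_inj := inv_inj hK.
apply: share_swap; first by rewrite val_one.
- by move=> j jl j1; rewrite /votes (negbTE jl) (negbTE j1).
(* [h] fixes [u] and maps the neighbours of [u] in basin [l] of one graph injectively to neighbours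
   in basin 1 of the other; the next case exchanges the two graphs. *)
- rewrite /votes !eqxx orbT /= val_one -(card_imset _ h_inj).
  apply/subset_leq_card/fintype.subsetP => c /imsetP[b].
  by rewrite inE ffunE hpair => /andP[/hl bl gb] ->; rewrite inE bl gb.
- rewrite /votes !eqxx orbT /= val_one -(card_imset _ h_inj).
  apply/subset_leq_card/fintype.subsetP => c /imsetP[b].
  by rewrite inE => /andP[/hl bl gb] ->; rewrite inE ffunE bl hpair hK gb.
Qed.

(** The means are nonpositive, so reaching [t] is a deviation of at least [t] above the mean; the
    leads are independent with second moments at most 1. *)
Lemma lead_tail f t : (#|basin f l| <= #|basin f 1|)%N -> 0 < t ->
  Ex law (fun g => (t <= \sum_(u in voters f) lead f u g)%R%:R)
    <= #|level2 k (edges f)|%:R / t ^+ 2.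
Proof.
move=> lel1 t0; have l0 := pmass_ge0 (edge_wt_ge0 (n := n) p01).
have l1 := pmass_sum1 (edge_wt_sum1 (n := n) p).
apply: (@le_trans _ _ (Ex law (fun g =>
   (\sum_(u in voters f) Ex law (lead f u) + t
     <= \sum_(u in voters f) lead f u g)%R%:R))).
  apply: le_Ex => // g; rewrite ler_nat; case: leP => //= le.
  rewrite (le_trans _ le) // gerDr; apply: sumr_le0 => u.
  exact: lead_mean_le0.
apply: le_trans (chebyshev l0 l1 _ t0) _.
  move=> u v uW vW uv; apply: Ex_indep (ballots_disjoint uW vW uv).
  - exact: edge_wt_sum1.
  - exact: lead_depends.
  - exact: lead_depends.
rewrite ler_pM2r ?invr_gt0 ?exprn_gt0 //.
apply: (@le_trans _ _ (\sum_(u in voters f) 1)).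
  apply: ler_sum => u _; rewrite -(Ex_cst l1 1); apply: le_Ex => // g.
  exact: lead_sqr_le1.
by rewrite sumr_const -[leLHS]/(_%:R) ler_nat subset_leq_card // subsetDl.
Qed.

End SecondRound.

(** * Sizes of the first-round basins *)

Lemma card_bigcup_le (I T : finType) (P : pred I) (F : I -> {set T}) :
  (#|\bigcup_(i | P i) F i| <= \sum_(i | P i) #|F i|)%N.
Proof.
elim/big_rec2: _ => [|i m X _ le]; first by rewrite cards0.
by apply: leq_trans (leq_card_setU _ _) _; rewrite leq_add2l.
Qed.

Lemma sum_inv_sqr_le2 (R : realFieldType) (N : nat) :
  \sum_(1 <= m < N) (m%:R ^+ 2)^-1 <= 2 :> R.
Proof.
case: N => [|[|N]]; [by rewrite big_geq|by rewrite big_geq|].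
(* The sharper bound passes through the induction because [1/(a+1)^2 <= 1/a - 1/(a+1)]. *)
suff : \sum_(1 <= m < N.+2) (m%:R ^+ 2)^-1 <= 2 - (N.+1%:R)^-1 :> R.
  by move=> h; apply: le_trans h _; rewrite gerBl.
elim: N => [|N IH]; first by rewrite big_nat1 expr1n !invr1; lra.
rewrite big_nat_recr //=; apply: le_trans (lerD IH (lexx _)) _.
have a0 : 0 < N.+1%:R :> R by rewrite ltr0n.
rewrite -[N.+2%:R]natr1; set a := N.+1%:R in a0 *.
have -> : 2 - a^-1 + ((a + 1) ^+ 2)^-1 =
    2 - (a + 1)^-1 - (a * (a + 1) ^+ 2)^-1.
  by field; rewrite !lt0r_neq0 //; lra.
by rewrite gerBl invr_ge0 mulr_ge0 ?sqr_ge0 // ltW.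
Qed.

(** Equivalent to [1 - (1-x)^m >= mx/(1+mx)], the form that bounds the gap between basin means from
    below. *)
Lemma bernoulli_inv (R : realFieldType) (x : R) m : 0 <= x <= 1 ->
  (1 - x) ^+ m * (1 + m%:R * x) <= 1.
Proof.
case/andP=> x0 x1; elim: m => [|m IH]; first by rewrite expr0; lra.
rewrite exprS -natr1; apply: le_trans IH.
have q0 : 0 <= (1 - x) ^+ m by rewrite exprn_ge0 // subr_ge0.
have m0 : 0 <= m%:R :> R by [].
rewrite mulrAC mulrC; apply: ler_wpM2l => //.
have : 0 <= (m%:R + 1) * x * x by rewrite !mulr_ge0 // addr_ge0.
lra.
Qed.

Lemma card_ord_below (m n : nat) : (m <= n)%N ->
  #|[set u : 'I_n | (u < m)%N]| = m.
Proof.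
move=> mn; have inj : injective (widen_ord mn).
  by move=> x y /(congr1 val) /= xy; apply: ord_inj.
rewrite -[RHS]card_ord -(card_imset _ inj).
apply: eq_card => u; rewrite inE; apply/idP/imsetP => [um|[i _ ->] /=].
  by exists (Ordinal um) => //; apply: ord_inj.
exact: ltn_ord.
Qed.

Section FirstRound.
Variables (R : realType) (n k : nat).
Implicit Types (f g : {ffun {set 'I_n} -> bool}) (u v w : 'I_n).

Local Notation edges := (@edges n).
Local Notation basin f j := (basin1 k (edges f) j).

(** These edges decide which basin contains [w]. They are disjoint for distinct [w] outside Level 1,
    whence independence. *)
Definition star w : {set {set 'I_n}} := [set [set v; w] | v in level1 n k].

(** Any of these edges would give [w] a label smaller than [j]. *)
Definition blockers (j : nat) w : {set {set 'I_n}} :=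
  [set [set v; w] | v : 'I_n & (v.+1 < j)%N].

Lemma star_disjoint u w : u \in ~: level1 n k -> w \in ~: level1 n k ->
  u != w -> [disjoint star u & star w].
Proof.
rewrite !finset.in_setC => uA wA uw; apply/pred0P => e /=; apply/negP.
case/andP=> /imsetP[v vA ->] /imsetP[v' v'A E].
have : u \in [set v'; w] by rewrite -E !inE eqxx orbT.
rewrite finset.in_set2 (negbTE uw) orbF => /eqP uv'.
by rewrite uv' v'A in uA.
Qed.

Hypothesis kn : (2 * k <= n)%N.

Lemma basinE f (j : nat) v w : (0 < j <= 2 * k)%N -> v.+1 = j ->
    w \in ~: level1 n k ->
  (w \in basin f j) = f [set v; w] && [forall e in blockers j w, ~~ f e].
Proof.
move=> jk vj; rewrite finset.in_setC => wA.
have vw u : (u.+1 <= j)%N -> u != w.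
  move=> uj; apply: contraNneq wA => <-; rewrite inE.
  by case/andP: jk => _; apply: leq_trans.
rewrite /basin1 finset.in_setD finset.in_setU (negbTE wA) /= andbC.
congr (_ && _).
  apply/bigcupP/idP => [[u /eqP uj]|fvw].
    rewrite inE adj_edges => /andP[_].
    by have -> // : u = v by apply: ord_inj; lia.
  by exists v; rewrite ?vj // inE adj_edges vw ?vj.
apply/negP/forall_inP => [H e /imsetP[u]|H /bigcupP[u uj]].
  rewrite inE => uj ->; apply/negP => fuw; apply/H/bigcupP; exists u => //.
  by rewrite inE adj_edges vw // ltnW.
rewrite inE adj_edges => /andP[_]; apply/negP/H.
by apply/imsetP; exists u; rewrite ?inE.
Qed.

Lemma basin_vertex (j : nat) : (0 < j <= 2 * k)%N -> exists v : 'I_n, v.+1 = j.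
Proof.
by case: j => // j jk; have jn : (j < n)%N by [lia]; exists (Ordinal jn).
Qed.

Lemma basin_depends (j : nat) w : (0 < j <= 2 * k)%N -> w \in ~: level1 n k ->
  depends_on (star w) (fun f => (w \in basin f j)%:R : R).
Proof.
move=> jk wA f g fg; have [v vj] := basin_vertex jk.
congr (_%:R); rewrite !(basinE _ jk vj wA).
have vA u : (u.+1 <= j)%N -> u \in level1 n k.
  by move=> uj; rewrite inE; case/andP: jk => _; apply: leq_trans.
congr (nat_of_bool (_ && _)).
  by apply: fg; apply/imsetP; exists v; rewrite ?vA ?vj.
apply: eq_forallb => e; case: (boolP (e \in blockers j w)) => //= /imsetP[u].
rewrite inE => uj ->; congr (~~ _); apply: fg.
by apply/imsetP; exists u; rewrite ?vA // ltnW.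
Qed.

Variable p : R.
Hypothesis p01 : 0 <= p <= 1.

Local Notation law := (pmass (edge_wt (n := n) p)).

Let law_ge0 : forall f, 0 <= law f := pmass_ge0 (edge_wt_ge0 p01).
Let law_sum1 : \sum_f law f = 1 := pmass_sum1 (edge_wt_sum1 p).

Lemma Ex_pattern (e0 : {set 'I_n}) (T : {set {set 'I_n}}) :
    e0 \in pairs n -> T \subset pairs n -> e0 \notin T ->
  Ex law (fun f => (f e0 && [forall e in T, ~~ f e])%:R)
    = p * (1 - p) ^+ #|T|.
Proof.
move=> e0P /fintype.subsetP TP e0T.
(* The indicator of the pattern is a product of functions of single edges, so [Ex_prod] computes its
   mean. *)
pose phi (e : {set 'I_n}) (b : bool) : R :=
  if e == e0 then b%:R else if e \in T then (~~ b)%:R else 1.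
transitivity (Ex law (fun f => \prod_e phi e (f e))).
  apply: eq_Ex => f; rewrite (bigD1 e0) //= {1}/phi eqxx.
  case: (f e0); rewrite /= ?mul0r // mul1r.
  case: (boolP [forall e in T, ~~ f e]) => [/forall_inP fT|].
    apply/esym/big1 => e ee0; rewrite /phi (negbTE ee0).
    by case: ifP => // /fT ->.
  rewrite negb_forall_in => /exists_inP[e eT /negPn fe].
  have ee0 : e != e0 by apply: contraNneq e0T => <-.
  by rewrite (bigD1 e) //= /phi (negbTE ee0) eT fe mul0r.
rewrite Ex_prod (bigD1 e0) //=; congr (_ * _).
  by rewrite /Ex big_bool /= /phi eqxx /edge_wt e0P mulr1 mulr0 addr0.
rewrite (bigID (mem T)) /= [X in _ * X]big1 => [|e /andP[ee0 eT]]; last first.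
  by rewrite /phi (negbTE ee0) (negbTE eT) Ex_cst // edge_wt_sum1.
rewrite mulr1 -prodr_const; apply: eq_big => e.
  by case: eqP => [->|] //=; rewrite (negbTE e0T).
case/andP=> ee0 eT; rewrite /Ex big_bool /= /phi (negbTE ee0) eT /edge_wt TP //.
by rewrite mulr1 mulr0 add0r.
Qed.

Lemma basin_prob (j : nat) w : (0 < j <= 2 * k)%N -> w \in ~: level1 n k ->
  Ex law (fun f => (w \in basin f j)%:R) = p * (1 - p) ^+ j.-1.
Proof.
move=> jk wA; have [v vj] := basin_vertex jk.
have vw u : (u.+1 <= j)%N -> u != w.
  move: wA; rewrite finset.in_setC => wA uj; apply: contraNneq wA => <-.
  by rewrite inE; case/andP: jk => _; apply: leq_trans.
have inj : {in [set u : 'I_n | (u.+1 < j)%N] &,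
    injective (fun u => [set u; w])}.
  move=> u u'; rewrite !inE => uj u'j E.
  have : u \in [set u'; w] by rewrite -E !inE eqxx.
  by rewrite !inE (negbTE (vw u (ltnW uj))) orbF => /eqP.
transitivity (Ex law (fun f =>
    (f [set v; w] && [forall e in blockers j w, ~~ f e])%:R)).
  by apply: eq_Ex => f; rewrite (basinE _ jk vj wA).
rewrite Ex_pattern.
- congr (_ * _ ^+ _); rewrite card_in_imset //.
  have jn : (j.-1 <= n)%N by case/andP: jk; lia.
  by rewrite -(card_ord_below jn); apply: eq_card => u; rewrite !inE; lia.
- by rewrite inE cards2 vw ?vj.
- apply/fintype.subsetP => e /imsetP[u]; rewrite !inE => uj ->.
  by rewrite cards2 vw // ltnW.
- apply/negP => /imsetP[u]; rewrite inE => uj E.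
  have : u \in [set v; w] by rewrite E !inE eqxx.
  rewrite !inE (negbTE (vw u (ltnW uj))) orbF => /eqP uv.
  by move: uj; rewrite uv vj ltnn.
Qed.

Lemma card_basin f (j : nat) :
  #|basin f j|%:R = \sum_(w in ~: level1 n k) (w \in basin f j)%:R :> R.
Proof.
rewrite -natr_sum -sum1_card; congr _%:R.
rewrite [LHS]big_mkcond [RHS]big_mkcond; apply: eq_bigr => w _.
rewrite finset.in_setC; case: (boolP (w \in level1 n k)) => [wA|_] /=.
  by rewrite /basin1 finset.in_setD finset.in_setU wA.
by case: (w \in _).
Qed.

Lemma card_low : #|~: level1 n k| = (n - 2 * k)%N.
Proof.
rewrite cardsCs finset.setCK card_ord; congr (_ - _)%N.
exact: card_ord_below.
Qed.

(** The mean size is [(n-2k)p <= M] and the sum of second moments of the indicators is also at most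
    [M], so a deviation by [M] has probability at most [M / M^2]. *)
Lemma basin1_big_prob : (0 < k)%N -> 0 < n%:R * p ->
  Ex law (fun f => (2 * (n%:R * p) <= #|basin f 1|%:R)%R%:R) <= (n%:R * p)^-1.
Proof.
move=> k0 M0; set M := n%:R * p in M0 *.
have k1 : (0 < 1 <= 2 * k)%N by lia.
pose Z w f : R := (w \in basin f 1)%:R.
have EZ w : w \in ~: level1 n k -> Ex law (Z w) = p.
  by move=> wA; rewrite /Z basin_prob // expr0 mulr1.
have EZs : \sum_(w in ~: level1 n k) p <= M.
  rewrite sumr_const -[leLHS]mulr_natl card_low; apply: ler_wpM2r.
    by case/andP: p01.
  by rewrite ler_nat leq_subr.
have := @chebyshev _ _ law law_ge0 law_sum1 _ (~: level1 n k) Z M _ M0.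
rewrite (eq_bigr _ EZ) => /(_ _)/le_trans cheb.
apply: le_trans (cheb _ _ _) => [|u w uA wA uw|].
- apply: le_Ex => // f; rewrite ler_nat; case: (leP (2 * M) _) => //= le.
  rewrite -card_basin; suff -> :
    \sum_(w in ~: level1 n k) p + M <= #|basin f 1|%:R by [].
  by apply: le_trans le; lra.
- apply: Ex_indep (star_disjoint uA wA uw); first exact: edge_wt_sum1.
  + exact: basin_depends.
  + exact: basin_depends.
- rewrite ler_pdivrMr ?exprn_gt0 // expr2 mulKf ?lt0r_neq0 //.
  apply: le_trans EZs; rewrite -(eq_bigr _ EZ); apply: ler_sum => w _.
  apply: le_Ex => // f; rewrite /Z; case: (w \in _) => //=.
  + by rewrite expr1n.
  + by rewrite expr0n.
Qed.

(** The difference of the two sizes has mean [-N mu], and must exceed it by [N mu] to become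
    positive. The bound decays like [(j-1)^-2], so its sum over [j] stays bounded by a constant
    times [1/(n p^3)]. *)
Lemma basin_order_prob (j : nat) : (2 <= j <= 2 * k)%N -> (4 * k <= n)%N ->
    0 < p -> (2 * k)%:R * p <= 3 ->
  Ex law (fun f => (#|basin f 1| < #|basin f j|)%N%:R)
    <= 64 / (n%:R * p ^+ 3) / j.-1%:R ^+ 2.
Proof.
move=> jk k4 p0 kp; have p1 : p <= 1 by case/andP: p01.
have k1 : (0 < 1 <= 2 * k)%N by lia.
have kj : (0 < j <= 2 * k)%N by lia.
pose m := j.-1; have m0 : 0 < m%:R :> R by rewrite ltr0n /m; lia.
have mp : m%:R * p <= 3.
  apply: le_trans kp; rewrite ler_pM2r // ler_nat /m.
  by case/andP: jk => _ ?; lia.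
pose N : R := (n - 2 * k)%:R.
have nN : n%:R <= 2 * N.
  by rewrite /N -natrM ler_nat; lia.
have n0 : 0 < n%:R :> R by rewrite ltr0n; lia.
have N0 : 0 < N by lra.
pose mu := p * (1 - (1 - p) ^+ m).
(* The 4 bounds the denominator [1 + mp] in [bernoulli_inv], since [mp <= 3]. *)
have mu_ge : m%:R * p ^+ 2 / 4 <= mu.
  have := bernoulli_inv m p01; set q := (1 - p) ^+ m => bq.
  have q1 : q <= 1 by rewrite exprn_ile1 // ?subr_ge0 ?gerBl // ltW.
  rewrite /mu -/q expr2; have : m%:R * p / 4 <= 1 - q.
    have : 0 <= m%:R * p by rewrite mulr_ge0 // ltW.
    by nra.
  nra.
have mu0 : 0 < mu.
  by apply: lt_le_trans mu_ge; rewrite divr_gt0 // mulr_gt0 // exprn_gt0.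
pose Z w f : R := (w \in basin f j)%:R - (w \in basin f 1)%:R.
have EZ w : w \in ~: level1 n k -> Ex law (Z w) = - mu.
  by move=> wA; rewrite /Z ExB !basin_prob // expr0 /mu; ring.
have t0 : 0 < N * mu by rewrite mulr_gt0.
have := @chebyshev _ _ law law_ge0 law_sum1 _ (~: level1 n k) Z _ _ t0.
rewrite (eq_bigr _ EZ) sumr_const card_low => /(_ _)/le_trans cheb.
apply: le_trans (cheb _ _ _) => [|u w uA wA uw|].
- apply: le_Ex => // f; rewrite ler_nat; case: ltnP => //= lt.
  rewrite -mulr_natl -/N mulrN addNr /Z sumrB -!card_basin subr_ge0.
  by rewrite ler_nat (ltnW lt).
- apply: Ex_indep (star_disjoint uA wA uw); first exact: edge_wt_sum1.
  + by move=> f g fg; rewrite /Z; congr (_ - _); apply: basin_depends fg.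
  + by move=> f g fg; rewrite /Z; congr (_ - _); apply: basin_depends fg.
- apply: (@le_trans _ _ (N * (2 * p) / (N * mu) ^+ 2)).
    rewrite ler_pM2r ?invr_gt0 ?exprn_gt0 //.
    rewrite /N -card_low mulr_natl -sumr_const; apply: ler_sum => w wA.
    apply: (@le_trans _ _ (Ex law (fun f =>
        (w \in basin f j)%:R + (w \in basin f 1)%:R))).
      apply: le_Ex => // f; rewrite /Z.
      by case: (w \in _); case: (w \in _); rewrite /= ?mulr1n ?mulr0n; lra.
    rewrite ExD !basin_prob // expr0 mulr1.
    have : (1 - p) ^+ m <= 1 by rewrite exprn_ile1 // ?subr_ge0 ?gerBl // ltW.
    by rewrite -/m; nra.
  have -> : N * (2 * p) / (N * mu) ^+ 2 = 2 * p / (N * mu ^+ 2).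
    by field; rewrite !lt0r_neq0.
  have -> : 64 / (n%:R * p ^+ 3) / m%:R ^+ 2 =
      2 * p / ((n%:R / 2) * (m%:R * p ^+ 2 / 4) ^+ 2).
    by field; rewrite !lt0r_neq0.
  have a0 : 0 < m%:R * p ^+ 2 / 4 by rewrite divr_gt0 // mulr_gt0 // exprn_gt0.
  have b0 : 0 < N * mu ^+ 2 by rewrite mulr_gt0 // exprn_gt0.
  have c0 : 0 < n%:R / 2 * (m%:R * p ^+ 2 / 4) ^+ 2.
    by rewrite mulr_gt0 ?exprn_gt0 // divr_gt0.
  rewrite ler_pM2l ?mulr_gt0 // lef_pV2 ?posrE //.
  apply: ler_pM.
  + by rewrite divr_ge0 // ltW.
  + exact: sqr_ge0.
  + by rewrite ler_pdivrMr // mulrC.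
  + by rewrite ler_sqr // nnegrE ltW.
Qed.

End FirstRound.

(** * Probability of failure *)

Lemma label_mass_sum1 (R : realType) (n k : nat) (E : {set {set 'I_n}}) u :
  (0 < k)%N -> \sum_(i : 'I_(2 * k).+1) label_mass R E u i = 1.
Proof.
move=> k0; rewrite /label_mass level23E finset.in_setC.
case: (boolP (u \in level1 n k)) => uA /=; last first.
  rewrite -big_mkcond sumr_const -[LHS]mulr_natr mulVf // pnatr_eq0 -lt0n.
  exact: max_labels_neq0.
have r1 : (round1 E u < (2 * k).+1)%N.
  by move: uA; rewrite inE ltnS; apply: leq_trans; apply: round1_le.
rewrite (bigD1 (Ordinal r1)) //= eqxx big1 ?addr0 // => i.
by rewrite -val_eqE /= eq_sym => /negbTE ->.
Qed.

Section Assembly.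
Variables (R : realType) (n k : nat) (p : R).
Hypotheses (p01 : 0 <= p <= 1) (k0 : (0 < k)%N).
Implicit Types (f g : {ffun {set 'I_n} -> bool}) (u v w : 'I_n).
Implicit Types (s : {ffun 'I_n -> 'I_(2 * k).+1}) (E : {set {set 'I_n}}).

Local Notation law := (pmass (edge_wt (n := n) p)).
Local Notation edges := (@edges n).
Local Notation basin f j := (basin1 k (edges f) j).

Let law_ge0 : forall f, 0 <= law f := pmass_ge0 (edge_wt_ge0 p01).
Let law_sum1 : \sum_f law f = 1 := pmass_sum1 (edge_wt_sum1 p).
Let one : 'I_(2 * k).+1 := inord 1.

Let val_one1 : one = 1%N :> nat.
Proof. by rewrite inordK //; lia. Qed.

Definition label_gap (l : 'I_(2 * k).+1) s u : R :=
  (s u == l)%:R - (s u == one)%:R.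

Definition mean_gap (l : 'I_(2 * k).+1) E u : R :=
  label_mass R E u l - label_mass R E u one.

(** Given the graph, the labels are independent and each gap lies in [{-1, 0, 1}], so its second
    moment is at most 1. *)
Lemma label_gap_tail (l : 'I_(2 * k).+1) E (V : {set 'I_n}) (t : R) : 0 < t ->
  Ex (labelling_mass R E) (fun s =>
      (\sum_(u in V) mean_gap l E u + t <= \sum_(u in V) label_gap l s u)%R%:R)
    <= #|V|%:R / t ^+ 2.
Proof.
move=> t0; pose lm := label_mass R (k := k) E.
have lm0 : forall u i, 0 <= lm u i by move=> u i; apply: label_mass_ge0.
have lm1 : forall u, \sum_i lm u i = 1 by move=> u; apply: label_mass_sum1.
have s0 := pmass_ge0 lm0; have s1 := pmass_sum1 lm1.
pose Z u s := label_gap l s u.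
have EZ u : Ex (pmass lm) (Z u) = mean_gap l E u.
  rewrite (Ex_marginal lm1 u (fun i => (i == l)%:R - (i == one)%:R)).
  by rewrite ExB !Ex_delta.
have := @chebyshev _ _ (pmass lm) s0 s1 _ V Z t _ t0.
rewrite (eq_bigr _ (fun u _ => EZ u)) => /(_ _)/le_trans cheb.
apply: cheb => [u v uV vV uv|].
  have dep w : depends_on [set w] (Z w).
    by move=> s s' ss'; rewrite /Z /label_gap ss' // inE.
  apply: Ex_indep (dep u) (dep v) _ => //.
  by rewrite disjoints1 inE.
rewrite ler_pM2r ?invr_gt0 ?exprn_gt0 // -sum1_card natr_sum.
apply: ler_sum => u _; rewrite -(Ex_cst s1 1%:R); apply: le_Ex => // s.
by rewrite /Z /label_gap; case: (_ == _); case: (_ == _);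
  rewrite /= ?mulr1n ?mulr0n; nra.
Qed.

Lemma basin2_gap (l : 'I_(2 * k).+1) f s :
  (basin2_size (edges f) s l)%:R - (basin2_size (edges f) s 1)%:R
    <= #|contest l f|%:R + \sum_(u in voters l f) label_gap l s u.
Proof.
have size2 (i : 'I_(2 * k).+1) : (basin2_size (edges f) s i)%:R =
    \sum_(u in level2 k (edges f)) (s u == i)%:R :> R.
  rewrite /basin2_size -natr_sum -sum1_card; congr _%:R.
  rewrite [LHS]big_mkcond [RHS]big_mkcond; apply: eq_bigr => u _.
  by rewrite [u \in [set _ | _]]inE; case: (u \in _) => //=;
    rewrite val_eqE; case: eqP.
have -> : basin2_size (edges f) s 1 = basin2_size (edges f) s one.
  by rewrite val_one1.
rewrite !size2 -sumrB (big_setID (contest l f)) /=.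
rewrite lerD2r; apply: (@le_trans _ _ #|level2 k (edges f) :&: contest l f|%:R).
  rewrite -sum1_card natr_sum; apply: ler_sum => u _.
  by case: (_ == _); case: (_ == _); rewrite /= ?mulr1n ?mulr0n; lra.
by rewrite ler_nat subset_leq_card // finset.subsetIr.
Qed.

Variable M : R.
Hypothesis M0 : 0 < M.

(** A condition on the first round only, hence unaffected by resampling the ballots. *)
Definition good E : bool :=
  [forall j : 'I_(2 * k).+1, (0 < j)%N ==>
    (#|basin1 k E j| <= #|basin1 k E 1|)%N]
  && (#|basin1 k E 1|%:R <= 2 * M).

Lemma good_le f (j : 'I_(2 * k).+1) : good (edges f) -> (0 < j)%N ->
  (#|basin f j| <= #|basin f 1|)%N.
Proof. by case/andP=> /forallP/(_ j)/implyP. Qed.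

(** Level 2 is covered by [2k] basins of size at most [2M] each. *)
Lemma good_level2 f : good (edges f) ->
  #|level2 k (edges f)|%:R <= 4 * k%:R * M.
Proof.
move=> gf; have sub : level2 k (edges f) \subset
    \bigcup_(j : 'I_(2 * k).+1 | (0 < j)%N) basin f j.
  apply/fintype.subsetP => u /level2_cover[j [j0 uj]].
  by apply/bigcupP; exists j.
have : (#|level2 k (edges f)| <= 2 * k * #|basin f 1|)%N.
  apply: leq_trans (subset_leq_card sub) _.
  apply: leq_trans (card_bigcup_le _ _) _.
  apply: (@leq_trans (\sum_(j : 'I_(2 * k).+1 | (0 < j)%N) #|basin f 1|)).
    by apply: leq_sum => j; apply: good_le.
  by rewrite big_mkcond big_ord_recl /= add0n sum_nat_const card_ord.
rewrite -(ler_nat R) !natrM => /le_trans; apply.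
case/andP: gf => _; have : 0 <= k%:R :> R by []; nra.
Qed.

(** The Chebyshev bound for at most [4kM] terms with second moments at most 1 and a deviation of
    [20M]; it equals [k/(100M)]. *)
Let c : R := 4 * k%:R * M / (20 * M) ^+ 2.

(** The budget [44M] splits into [4M] for the contested basins, [20M] for the mean gap given the
    graph and [20M] for the random labels. *)
Definition bad (l : 'I_(2 * k).+1) E s : bool :=
  44 * M < (basin2_size E s l)%:R - (basin2_size E s 1)%:R.

(** When the mean gap is below [20M], a bad labelling must deviate from it by at least [20M].
    Otherwise the indicator on the right makes the bound trivial. *)
Lemma bad_labels (l : 'I_(2 * k).+1) f : (2 <= l)%N -> good (edges f) ->
  \sum_(s | bad l (edges f) s) labelling_mass R (edges f) s
    <= (20 * M <= \sum_(u in voters l f) mean_gap l (edges f) u)%R%:R + c.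
Proof.
move=> l2 gf; have t0 : 0 < 20 * M by rewrite mulr_gt0.
have lm0 : forall u i, 0 <= label_mass R (k := k) (edges f) u i.
  by move=> u i; apply: label_mass_ge0.
have s1 : \sum_(s : {ffun 'I_n -> 'I_(2 * k).+1})
    labelling_mass R (edges f) s = 1 by apply: labelling_mass_sum1.
have s0 : forall s : {ffun 'I_n -> 'I_(2 * k).+1},
    0 <= labelling_mass R (edges f) s.
  by move=> s; apply: prodr_ge0.
have c0 : 0 <= c.
  by rewrite /c divr_ge0 ?sqr_ge0 // !mulr_ge0 // ltW.
case: (leP (20 * M) _) => [_|small] /=.
  apply: (@le_trans _ _ 1); last by rewrite lerDl.
  by rewrite -s1 [leRHS](bigID (bad l (edges f))) /= lerDl sumr_ge0.
rewrite add0r.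
apply: (@le_trans _ _ (#|voters l f|%:R / (20 * M) ^+ 2)); last first.
  rewrite ler_pM2r ?invr_gt0 ?exprn_gt0 //; apply: le_trans (good_level2 gf).
  by rewrite ler_nat subset_leq_card // finset.subsetDl.
apply: le_trans (label_gap_tail l (edges f) (voters l f) t0).
rewrite big_mkcond /=; apply: ler_sum => s _.
case: ifPn => [bads|_]; last first.
  by rewrite mulr_ge0.
rewrite ler_peMr // -[leLHS]/(1%:R) ler_nat lt0b.
have := basin2_gap l f s; move: bads; rewrite /bad.
have : #|contest l f|%:R <= 4 * M.
  apply: (@le_trans _ _ (#|basin f 1|%:R + #|basin f 1|%:R)).
    rewrite -natrD ler_nat; apply: leq_trans (leq_card_setU _ _) _.
    by rewrite leq_add2l good_le //; lia.
  by case/andP: gf => _; lra.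
lra.
Qed.

(** Resampling the ballots keeps [good] and the voters fixed and turns the mean gaps into leads, to
    which [lead_tail] applies for each fixed [f]. *)
Lemma bad_graphs (l : 'I_(2 * k).+1) : (2 <= l)%N ->
  Ex law (fun f => (good (edges f) &&
      (20 * M <= \sum_(u in voters l f) mean_gap l (edges f) u))%R%:R) <= c.
Proof.
move=> l2; have t0 : 0 < 20 * M by rewrite mulr_gt0.
have c0 : 0 <= c.
  by rewrite /c divr_ge0 ?sqr_ge0 // !mulr_ge0 // ltW.
rewrite (resample (S := all_ballots l) (edge_wt_sum1 p)); last first.
  by move=> f g; apply: all_ballots_mix.
rewrite -(Ex_cst law_sum1 c); apply: le_Ex => // f.
have goodE g : good (edges (mix (all_ballots l f) f g)) = good (edges f).
  have top := mix_top l2 f g; rewrite /good (basin_top top) //; last by lia.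
  congr (_ && _); apply: eq_forallb => j; rewrite (basin_top top) //.
  by have := ltn_ord j; lia.
have [gf|ngf] := boolP (good (edges f)); last first.
  apply: (@le_trans _ _ (Ex law (fun=> 0))); last by rewrite Ex_cst.
  apply: le_Ex => // g.
  by rewrite goodE (negbTE ngf).
apply: (@le_trans _ _ (#|level2 k (edges f)|%:R / (20 * M) ^+ 2)); last first.
  by rewrite ler_pM2r ?invr_gt0 ?exprn_gt0 // good_level2.
have l0 : (0 < l)%N by lia.
apply: le_trans (lead_tail l2 p01 (good_le gf l0) t0).
apply: le_Ex => // g; rewrite goodE gf /= (voters_top l2 (mix_top l2 f g)).
rewrite ler_nat; case: leP => //= le; rewrite lt0b; apply: le_trans le _.
by apply: ler_sum => u uW; rewrite /mean_gap lead_mix.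
Qed.

End Assembly.

(** The error terms account for basin 1 being too large, for another basin exceeding it, and for the
    union over [l] of bad graphs and bad labels. *)
Lemma alap_pr_ge (R : realType) (n k : nat) (p : R) :
    0 <= p <= 1 -> (0 < k)%N -> (4 * k <= n)%N -> 0 < p ->
    (2 * k)%:R * p <= 3 ->
  1 - ((n%:R * p)^-1 + 128 / (n%:R * p ^+ 3) + k%:R ^+ 2 / (25 * (n%:R * p)))
  <= @alap_pr R n k p (fun E s =>
       [forall l : 'I_(2 * k).+1, (2 <= l)%N ==>
          ((basin2_size E s l)%:R - (basin2_size E s 1)%:R
             <= 44 * (n%:R * p) :> R)]).
Proof.
move=> p01 k0 k4 p0 kp; set ev := (X in alap_pr _ X); set M := n%:R * p.
have n0 : 0 < n%:R :> R by rewrite ltr0n; lia.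
have M0 : 0 < M by rewrite mulr_gt0.
pose law := pmass (edge_wt (n := n) p).
have law0 : forall f, 0 <= law f := pmass_ge0 (edge_wt_ge0 p01).
have law1 : \sum_f law f = 1 := pmass_sum1 (edge_wt_sum1 p).
pose c : R := 4 * k%:R * M / (20 * M) ^+ 2.
have c0 : 0 <= c by rewrite /c divr_ge0 ?sqr_ge0 // !mulr_ge0 // ltW.
pose gd E := @good R n k M E.
pose Q (l : 'I_(2 * k).+1) (f : {ffun {set 'I_n} -> bool}) : bool :=
  (20 * M <= \sum_(u in voters l f) mean_gap R l (edges f) u).
have P_not_good : Ex law (fun f => (~~ gd (edges f))%:R) <=
    M^-1 + 128 / (n%:R * p ^+ 3).
  have kn : (2 * k <= n)%N by lia.
  pose J (j : 'I_(2 * k).+1) f : R :=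
    (#|basin1 k (@edges n f) 1| < #|basin1 k (@edges n f) j|)%N%:R.
  pose H f : R := (2 * M <= #|basin1 k (@edges n f) 1|%:R)%R%:R.
  apply: (@le_trans _ _ (Ex law (fun f =>
      H f + \sum_(j : 'I_(2 * k).+1 | (2 <= j)%N) J j f))).
    apply: le_Ex => // f; rewrite /gd /good negb_and.
    have J0 : 0 <= \sum_(j : 'I_(2 * k).+1 | (2 <= j)%N) J j f.
      by apply: sumr_ge0.
    case: (boolP [forall j, _]) => [_|] /=.
      apply: ler_wpDr => //; rewrite -ltNge /H ler_nat.
      by case: ltP => //= lt; rewrite ltW.
    rewrite negb_forall => /existsP[j]; rewrite negb_imply -ltnNge =>
      /andP[j0 lt].
    have j2 : (2 <= j)%N.
      by rewrite ltnNge; apply: contraL lt => j1; have -> : j = 1%N :> nat;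
        [lia|rewrite ltnn].
    apply: ler_wpDl => //; rewrite (bigD1 j) //= {1}/J lt lerDl.
    by apply: sumr_ge0.
  rewrite ExD Ex_sum; apply: lerD; first exact: basin1_big_prob.
  apply: (@le_trans _ _ (64 / (n%:R * p ^+ 3) *
      \sum_(1 <= m < (2 * k)) (m%:R ^+ 2)^-1)).
    (* The cut-off makes the terms at 0 and 1 vanish, so the sum over labels becomes the sum over
       [m = j - 1] from 1. *)
    pose F (j : nat) : R :=
      if (2 <= j)%N then 64 / (n%:R * p ^+ 3) / j.-1%:R ^+ 2 else 0.
    apply: (@le_trans _ _ (\sum_(j < (2 * k).+1) F j)).
      rewrite [leRHS](bigID (fun j : 'I_(2 * k).+1 => (2 <= j)%N)) /=.
      rewrite [X in _ <= _ + X]big1 ?addr0 => [|j /negbTE j2];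
        last by rewrite /F j2.
      apply: ler_sum => j j2; rewrite /F j2; apply: basin_order_prob => //.
      by rewrite j2 /=; have := ltn_ord j; lia.
    rewrite mulr_sumr -(big_mkord xpredT F) big_ltn // {1}/F /= add0r.
    rewrite big_ltn ?ltnS ?muln_gt0 // {1}/F /= add0r.
    rewrite big_add1 /= le_eqVlt; apply/orP; left; apply/eqP.
    by apply: eq_big_nat => j /andP[j1 _]; rewrite /F ltnS j1.
  have -> : 128 / (n%:R * p ^+ 3) = 64 / (n%:R * p ^+ 3) * 2 by ring.
  apply: ler_wpM2l (sum_inv_sqr_le2 _ _).
  by rewrite divr_ge0 // mulr_ge0 // ?exprn_ge0 // ltW.
have fixed_graph (f : {ffun {set 'I_n} -> bool}) :
    \sum_(s | ~~ ev (edges f) s) labelling_mass R (edges f) s <=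
    (~~ gd (edges f))%:R +
    \sum_(l : 'I_(2 * k).+1 | (2 <= l)%N) ((gd (edges f) && Q l f)%:R + c).
  have lm0 (s : {ffun 'I_n -> 'I_(2 * k).+1}) :
      0 <= labelling_mass R (edges f) s.
    by apply: prodr_ge0 => u _; apply: label_mass_ge0.
  have [gf|ngf] := boolP (gd (edges f)); last first.
    apply: ler_wpDr; first by apply: sumr_ge0 => l _; rewrite addr_ge0.
    rewrite -[leRHS](labelling_mass_sum1 R (edges f) k0).
    by rewrite [leRHS](bigID (fun s => ~~ ev (edges f) s)) /= lerDl sumr_ge0.
  apply: (@le_trans _ _ (\sum_(l : 'I_(2 * k).+1 | (2 <= l)%N)
      \sum_(s | bad M l (edges f) s) labelling_mass R (edges f) s)).
    rewrite (exchange_big_dep xpredT) //= big_mkcond; apply: ler_sum => s _.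
    case: ifPn => [|_]; last by rewrite sumr_ge0.
    rewrite negb_forall => /existsP[l]; rewrite negb_imply => /andP[l2 badl].
    rewrite (bigD1 l) /=; last by rewrite l2 /bad ltNge.
    by rewrite lerDl sumr_ge0.
  by rewrite /= add0r; apply: ler_sum => l l2; apply: bad_labels.
suff : @alap_pr R n k p (fun E s => ~~ ev E s) <=
    M^-1 + 128 / (n%:R * p ^+ 3) + k%:R ^+ 2 / (25 * M).
  have <- : @alap_pr R n k p ev + @alap_pr R n k p (fun E s => ~~ ev E s) = 1.
    rewrite -(alap_prT n p k0) /alap_pr -big_split; apply: eq_bigr => E _ /=.
    rewrite -mulrDr; congr (_ * _).
    by rewrite [RHS](bigID (ev E)).
  lra.
rewrite /alap_pr gnp_Ex; apply: le_trans (le_Ex law0 fixed_graph) _.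
rewrite ExD; apply: lerD => //; rewrite Ex_sum.
apply: (@le_trans _ _ (\sum_(l : 'I_(2 * k).+1 | (2 <= l)%N) (c + c))).
  apply: ler_sum => l l2; rewrite ExD (Ex_cst law1) lerD2r.
  exact: bad_graphs.
(* One [c] comes from the graph and one from the labels, for at most [2k] values of [l]. *)
have -> : k%:R ^+ 2 / (25 * M) = (2 * k)%:R * (c + c).
  by rewrite /c natrM; field; rewrite lt0r_neq0.
rewrite big_mkcond big_ord_recl /= add0r mulr_natl -[X in _ *+ X]card_ord.
rewrite -sumr_const; apply: ler_sum => l _; case: ifP => // _.
exact: addr_ge0.
Qed.

Lemma alap_pr_le1 (R : realType) (n k : nat) (p : R)
    (ev : {set {set 'I_n}} -> {ffun 'I_n -> 'I_(2 * k).+1} -> bool) :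
  0 <= p <= 1 -> (0 < k)%N -> alap_pr p ev <= 1.
Proof.
move=> p01 k0; rewrite -(alap_prT n p k0) /alap_pr; apply: ler_sum => E _.
apply: ler_wpM2l; first exact: gnp_mass_ge0.
rewrite [leRHS](bigID (ev E)) /= lerDl; apply: sumr_ge0 => s _.
by apply: prodr_ge0 => u _; apply: label_mass_ge0.
Qed.

(** * Numerical estimates in terms of the twelfth root of n *)

Lemma ln_sqrt_bound (R : realType) (N y : R) : 1 <= y -> N = y ^+ 12 ->
  Num.sqrt (N^-1 * ln N) <= 4 / y ^+ 5.
Proof.
move=> y1 ->; have y0 : 0 < y by lra.
(* From [ln y <= y - 1]; the crude right-hand side is chosen to be a perfect square. *)
have lny : ln (y ^+ 12) <= 16 * y ^+ 2.
  have ln_y : ln y <= y - 1.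
    by rewrite -{1}[y](subrKC 1) le_ln1Dx //; lra.
  by rewrite lnXn // -mulr_natl; nra.
have -> : 4 / y ^+ 5 = Num.sqrt ((4 / y ^+ 5) ^+ 2).
  by rewrite sqrtr_sqr ger0_norm // divr_ge0 // exprn_ge0 // ltW.
apply: ler_wsqrtr; rewrite mulrC ler_pdivrMr ?exprn_gt0 //.
have -> // : (4 / y ^+ 5) ^+ 2 * y ^+ 12 = 16 * y ^+ 2.
by field; rewrite lt0r_neq0.
Qed.

(* Here y stands for n^(1/12), and d is an arbitrarily small constant given by
   the lower bound on p. *)
Lemma error_bound (R : realType) (n : nat) (p : nat -> R) (y d : R) :
    0 <= p n <= 1 -> n%:R = y ^+ 12 -> 244 <= y -> 0 < d <= 1 ->
    1 <= d * p n * y ^+ 4 ->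
  let k := alap_k p n in
  [/\ (0 < k)%N, (4 * k <= n)%N, 0 < p n, (2 * k)%:R * p n <= 3 &
   (n%:R * p n)^-1 + 128 / (n%:R * p n ^+ 3) + k%:R ^+ 2 / (25 * (n%:R * p n))
     <= 150 / y + 128 * d].
Proof.
move=> /andP[pn0 pn1] ny y244 /andP[d0 d1]; set q := p n in pn0 pn1 *.
move=> dqy k.
have y0 : 0 < y by lra.
have Y m : 0 < y ^+ m by apply: exprn_gt0.
have q0 : 0 < q.
  by rewrite lt_neqAle pn0 andbT; apply: contraTneq dqy => <-;
    rewrite mulr0 mul0r -ltNge.
have qy : 1 <= q * y ^+ 4.
  by apply: le_trans dqy _; rewrite -mulrA ler_piMl // mulr_ge0 // ltW.
pose s := Num.sqrt (n%:R^-1 * ln n%:R : R).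
have s_le : s <= 4 / y ^+ 5 by apply: ln_sqrt_bound => //; lra.
have n1 : 1 < n%:R :> R by rewrite ny exprn_egt1 //; lra.
have s0 : 0 < s by rewrite sqrtr_gt0 mulr_gt0 ?ln_gt0 // invr_gt0; lra.
have qinv : q^-1 <= y ^+ 4.
  by rewrite -[leLHS]mul1r ler_pdivrMr // mulrC.
pose x := 15 * q ^- 2 * s.
have x0 : 0 < x by rewrite !mulr_gt0 // invr_gt0 exprn_gt0.
have kx : k%:R <= x + 1.
  have c0 : (0 <= Num.ceil x)%R by rewrite ceil_ge0; lra.
  have -> : k%:R = (Num.ceil x)%:~R :> R by rewrite -[in RHS](gez0_abs c0).
  by have := ceilB1_lt x; rewrite intrB; lra.
have k0 : (0 < k)%N.
  by rewrite /k /alap_k absz_gt0 lt0r_neq0 // ceil_gt0.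
have xq : x * q <= 60 / y.
  have -> : x * q = 15 * (q^-1 * s) by rewrite /x; field; rewrite lt0r_neq0.
  have -> : 60 / y = 15 * (y ^+ 4 * (4 / y ^+ 5)) by field; rewrite lt0r_neq0.
  by rewrite ler_pM2l // ler_pM // ltW // invr_gt0.
have x_le : x <= 60 * y ^+ 3.
  have -> : x = 15 * (q^-1 * (q^-1 * s)) by rewrite /x; field;
    rewrite lt0r_neq0.
  have -> : 60 * y ^+ 3 = 15 * (y ^+ 4 * (y ^+ 4 * (4 / y ^+ 5))).
    by field; rewrite lt0r_neq0.
  have qi0 : 0 <= q^-1 by rewrite ltW // invr_gt0.
  by rewrite ler_pM2l // !ler_pM // ?mulr_ge0 // ltW.
have y3 : 1 <= y ^+ 3 by rewrite exprn_ege1 //; lra.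
have k_le : k%:R <= 61 * y ^+ 3 by lra.
have nq : y ^+ 8 <= n%:R * q.
  have -> : n%:R * q = y ^+ 8 * (q * y ^+ 4) by rewrite ny; ring.
  by rewrite ler_peMr // ltW.
have nq0 : 0 < n%:R * q by apply: lt_le_trans nq.
split => //.
(* Here [4k <= 244 y^3], which explains the lower bound on [y]. *)
- rewrite -(ler_nat R) natrM; apply: (@le_trans _ _ (y * y ^+ 3)); first by nra.
  by rewrite ny -exprS ler_eXn2l //; lra.
(* Since [k <= x + 1], this gives [2kq <= 2xq + 2q <= 1 + 2]. *)
- have : 60 / y <= 1 / 2 by rewrite ler_pdivrMr //; lra.
  by rewrite natrM; nra.
- have t1 : (n%:R * q)^-1 <= 1 / y.
    rewrite div1r lef_pV2 ?posrE //; apply: le_trans nq.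
    by rewrite exprS ler_peMr ?exprn_ege1 //; lra.
  have t2 : 128 / (n%:R * q ^+ 3) <= 128 * d.
    rewrite ler_pM2l // -div1r ler_pdivrMr; last first.
      by rewrite mulr_gt0 ?exprn_gt0 //; lra.
    apply: le_trans dqy _.
    have -> : d * (n%:R * q ^+ 3) = d * q * y ^+ 4 * (q * y ^+ 4) ^+ 2.
      by rewrite ny; ring.
    by rewrite ler_peMr ?exprn_ege1 // !mulr_ge0 // ltW.
  have t3 : k%:R ^+ 2 / (25 * (n%:R * q)) <= 149 / y.
    (* The quotient is [(3721/25) / y^2], and [3721/25 < 149]. *)
    apply: (@le_trans _ _ ((61 * y ^+ 3) ^+ 2 / (25 * y ^+ 8))).
      rewrite ler_pM ?sqr_ge0 ?invr_ge0 ?mulr_ge0 //.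
        by rewrite ler_sqr ?nnegrE //; lra.
      by rewrite lef_pV2 ?posrE;
        [rewrite ler_pM2l|exact: mulr_gt0|exact: mulr_gt0].
    have -> : (61 * y ^+ 3) ^+ 2 / (25 * y ^+ 8) = (3721 / 25 / y) / y.
      by field; rewrite lt0r_neq0.
    rewrite ler_pM2r ?invr_gt0 // ler_pdivrMr //; lra.
  have : 150 / y = 1 / y + 149 / y by rewrite -mulrDl; congr (_ / _); ring.
  lra.
Qed.

(** * Passage to the limit *)

Local Open Scope classical_set_scope.
Local Open Scope ring_scope.

Theorem lemma3p15 (R : realType) (p : nat -> R)
  (p01 : forall n : nat, 0 <= p n <= 1)
  (np_lower : (fun n : nat => (n%:R : R) `^ (2 / 3) : R^o)
                =o_\oo (fun n : nat => n%:R * p n : R^o))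
  (np_upper : \forall n \near \oo,
     n%:R * p n
       <= Num.sqrt 15 * (n%:R : R) `^ (3 / 4) * (ln (n%:R : R)) `^ (1 / 4)) :
  (fun n : nat =>
     @alap_pr R n (alap_k p n) (p n) (fun E s =>
       [forall l : 'I_(2 * alap_k p n).+1, (2 <= l)%N ==>
          ((basin2_size E s l)%:R - (basin2_size E s 1)%:R
             <= 44 * (n%:R * p n) :> R)]))
    @ \oo --> (1 : R).
Proof.
apply/cvgrPdist_le => e e0.
(* [d] and [Y] are chosen so that [128 d] and [150 / y] are each at most [e / 2]. *)
pose d := Num.min 1 (e / 256).
have d01 : 0 < d <= 1 by rewrite lt_min ltr01 divr_gt0 // ge_min lexx.
have de : 128 * d <= e / 2.
  have : d <= e / 256 by rewrite ge_min lexx orbT.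
  lra.
pose Y := 244 + 300 / e.
have Y244 : 244 <= Y by rewrite lerDl divr_ge0 // ltW.
have [d0 d1] := andP d01.
have := (eqoP _ _ _).1 np_lower d d0.
move=> small; near=> n.
(* A twelfth root turns the fractional powers of [n] into integer powers: [n^(2/3)] is [y^8]. *)
pose y : R := n%:R `^ (12^-1).
have n0 : (0 : R) <= n%:R by [].
have powy (a : R) m : a = m%:R / 12 -> n%:R `^ a = y ^+ m.
  move=> ->; rewrite -powR_mulrn ?powR_ge0 // /y -powRrM; congr (_ `^ _).
  by rewrite mulrC.
have ny : n%:R = y ^+ 12.
  by rewrite -(powy 1) ?powRr1 // divff.
have y0 : 0 <= y by apply: powR_ge0.
have yY : Y <= y.
  rewrite -(ler_pXn2r (n := 12)) ?nnegrE //; last by lra.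
  by rewrite -ny; near: n; apply: nbhs_infty_ger.
have y244 : 244 <= y by lra.
(* This is [n^(2/3) <= d n p] divided by [y^8]. *)
have dpy : 1 <= d * p n * y ^+ 4.
  have : `|n%:R `^ (2 / 3)| <= d * `|n%:R * p n| by near: n.
  have [/andP[pn0 _]] := p01 n.
  rewrite ger0_norm ?powR_ge0 // ger0_norm ?mulr_ge0 //.
  rewrite (powy _ 8); last by field.
  have -> : d * (n%:R * p n) = d * p n * y ^+ 4 * y ^+ 8 by rewrite ny; ring.
  by rewrite ler_pMl // exprn_gt0 //; lra.
have [k0 k4 pn0 kp err] := error_bound (p01 n) ny y244 d01 dpy.
have ge := alap_pr_ge (p01 n) k0 k4 pn0 kp.
rewrite ger0_norm ?subr_ge0; last exact: alap_pr_le1.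
have ey : 150 / y <= e / 2.
  rewrite ler_pdivrMr; last by lra.
  have -> : 150 = e / 2 * (300 / e) by field; rewrite lt0r_neq0.
  by rewrite ler_pM2l ?divr_gt0 //; apply: le_trans yY; rewrite /Y lerDr.
lra.
Unshelve. all: by end_near.
Qed.
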